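(* Let $n\ge3$ and let $G=G_n(g,f)$ be a proper Riordan graph. If one of the following holds, then $G$ is Hamiltonian: (i) there exists $i\in\{2,\ldots,n-1\}$ such that $[t^{i-1}]g\equiv1$ and $[t^{n-2}](gf^{\,i-1})\equiv 1$; (ii) $[t]g\equiv 1$ and $[t^2]f\equiv 0$.
   Context: $\equiv$ is congruence mod $2$, and $[t^k]u$ is the coefficient of $t^k$ in $u$. For $g,f\in\mathbb{Z}[[t]]$ (or $\mathbb{Z}_2[[t]]$) with $f(0)=0$, the Riordan graph $G_n(g,f)$ is the simple graph on $[n]=\{1,\dots,n\}$ in which, for $i>j\ge1$, $i$ and $j$ are adjacent iff $[t^{i-2}]\,g f^{\,j-1}\equiv 1$. It is proper if $g(0)\equiv f'(0)\equiv1$. A graph is Hamiltonian if it has a Hamiltonian cycle, i.e. a cycle (of length at least $3$) through every vertex. *)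

(* Defs.v *)
From mathcomp Require Import all_boot all_order all_algebra.

Set Implicit Arguments.
Unset Strict Implicit.
Unset Printing Implicit Defensive.

Import GRing.Theory.
Local Open Scope ring_scope.

(* A formal power series is its coefficient sequence: [t^k] u is u k. *)
Definition fps (R : comNzRingType) := nat -> R.

Section PowerSeries.
Variable R : comNzRingType.
Implicit Types u v : fps R.

Definition fps_one : fps R := fun k => (k == 0%N)%:R.
Definition fps_mul u v : fps R := fun k => \sum_(i < k.+1) u i * v (k - i)%N.
Definition fps_exp u (m : nat) : fps R := iter m (fps_mul u) fps_one.
Definition fps_deriv u : fps R := fun k => u k.+1 *+ k.+1.

End PowerSeries.

(* The two admissible coefficient rings, Z and the integers mod 2; on the
   latter, congruence mod 2 is equality. *)
Variant coef_ring := CoefZ | CoefZ2.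

Definition coef_sort (c : coef_ring) : comNzRingType :=
  match c with CoefZ => int | CoefZ2 => 'Z_2 end.
Coercion coef_sort : coef_ring >-> GRing.ComNzRing.type.

Definition cong2 (c : coef_ring) : rel c :=
  match c with
  | CoefZ => fun a b : int => (a == b %[mod 2])%Z
  | CoefZ2 => fun a b : 'Z_2 => a == b
  end.

Section RiordanGraph.
Variables (c : coef_ring) (g f : fps c).

(* Only used for i > j >= 1, so neither subtraction truncates. *)
Definition riordan_entry (i j : nat) : bool :=
  cong2 (fps_mul g (fps_exp f (j - 1)%N) (i - 2)%N) 1.

Definition riordan_adj (i j : nat) : bool :=
  ((j < i)%N && riordan_entry i j) || ((i < j)%N && riordan_entry j i).

(* The element v : 'I_n (0 <= v < n) stands for the vertex v.+1 of [n]. *)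
Definition riordan_graph (n : nat) : rel 'I_n :=
  fun v w => riordan_adj v.+1 w.+1.

Definition riordan_proper : bool :=
  cong2 (g 0%N) 1 && cong2 (fps_deriv f 0%N) 1.

End RiordanGraph.

Arguments riordan_graph [c] g f n _ _.

Definition hamiltonian (T : finType) (e : rel T) : Prop :=
  exists s : seq T,
    [/\ (2 < size s)%N, uniq s, cycle e s & forall v : T, v \in s].

(* Main.v *)
Require Import Defs.
From mathcomp Require Import all_boot all_order all_algebra.
From mathcomp Require Import zify.

Local Open Scope ring_scope.

(** Properness makes every pair of consecutive vertices adjacent, because the
    coefficient that decides the edge between [j] and [j + 1] is the leading
    one, [g(0) f'(0)^(j-1)]: the graph contains the path [1 - 2 - ... - n]
    ([riordan_adj_succ]).  Each condition supplies the chords that turn this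
    path into a cycle.

    (i) The two hypotheses are exactly the edges [1 - (i+1)] and [i - n], and
    [1 - 2 - ... - i - n - (n-1) - ... - (i+1) - 1] is a Hamiltonian cycle
    ([hamiltonian_crossing_chords]).

    (ii) As [f] vanishes at 0, the edge between [j] and [j + 2] is decided by
    the second lowest coefficient of [g f^(j-1)], namely
    [g_1 f_1^(j-1) + (j-1) g_0 f_1^(j-2) f_2], which is odd
    ([riordan_adj_succ2]).  The graph then contains the square of the path, and
    the odd vertices in increasing order followed by the even ones in decreasing
    order form a Hamiltonian cycle ([hamiltonian_path_square]). *)

Import GRing.Theory.

(** * Hamiltonian cycles around a path *)

(** Cycles are assembled from plain numbers, so that concatenation and reversal
    carry no proofs that the entries lie below [n]. *)
Lemma hamiltonian_relpre_val (r : rel nat) (n : nat) (s : seq nat) :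
  (2 < n)%N -> perm_eq s (iota 0 n) -> cycle r s ->
  hamiltonian (fun v w : 'I_n => r v w).
Proof.
move=> n_gt2 s_iota cyc.
have s_lt : all (fun k => k < n)%N s.
  by apply/allP=> k; rewrite (perm_mem s_iota) mem_iota add0n.
have [t def_s] : exists t : seq 'I_n, s = map val t.
  elim: s s_lt {s_iota cyc} => [|k s IHs] /=; first by exists [::].
  by case/andP=> k_lt /IHs[t ->]; exists (Ordinal k_lt :: t).
exists t; split.
- by rewrite -(size_map val) -def_s (perm_size s_iota) size_iota.
- by rewrite -(map_inj_uniq val_inj) -def_s (perm_uniq s_iota) iota_uniq.
- by rewrite def_s cycle_map in cyc.
- move=> v; rewrite -(mem_map val_inj) -def_s (perm_mem s_iota) mem_iota.
  by rewrite add0n ltn_ord.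
Qed.

Lemma path_iota (r : rel nat) (a m : nat) :
  (forall j, r j j.+1) -> path r a (iota a.+1 m).
Proof. by move=> rS; elim: m a => //= m IHm a; rewrite rS IHm. Qed.

Lemma last_iota (a m : nat) : last a (iota a.+1 m) = (a + m)%N.
Proof. by elim: m a => [|m IHm] a /=; rewrite ?addn0 // IHm addnS. Qed.

(** The asymmetric shape, last vertex outside [p], is what [cycle] unfolds to
    when a cycle is cut into an outgoing and a returning path. *)
Lemma rev_path_rcons (T : Type) (r : rel T) (x y : T) (p : seq T) :
  symmetric r -> path r x (rcons p y) -> path r y (rcons (rev p) x).
Proof.
move=> r_sym; have := rev_path r x (rcons p y).
rewrite last_rcons belast_rcons rev_cons => -> rp.
by rewrite (eq_path (e' := r)) // => u v; rewrite r_sym.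
Qed.

(** Removing the edge [k - (k+1)] from the path [0 - 1 - ... - (n-1)] leaves two
    segments; the chords [0 - (k+1)] and [k - (n-1)] join their ends into a
    cycle. *)
Lemma hamiltonian_crossing_chords (r : rel nat) (n k : nat) :
  symmetric r -> (forall j, r j j.+1) -> (2 < n)%N -> (k.+1 < n)%N ->
  r 0%N k.+1 -> r k n.-1 ->
  hamiltonian (fun v w : 'I_n => r v w).
Proof.
move=> r_sym rS n_gt2 k_lt r0k rkn.
have [m def_n] : exists m, n = (k.+1 + m.+1)%N.
  by exists (n - k.+2)%N; rewrite addnS -addSn subnKC.
apply: (hamiltonian_relpre_val _ _ (iota 0 k.+1 ++ rev (iota k.+1 m.+1))) => //.
  by rewrite def_n iotaD add0n perm_cat2l perm_rev.
rewrite /= rcons_cat cat_path path_iota //= last_iota add0n.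
apply: rev_path_rcons => //=; rewrite r0k rcons_path path_iota //= last_iota.
by rewrite r_sym; move: rkn; rewrite def_n addnS.
Qed.

(** Reversing the path for [m] and putting [m + 2] in front of it, next to [m],
    gives the path for [m + 1]: this is why the two largest vertices are kept
    as end points. *)
Lemma path_square_spanning (r : rel nat) (m : nat) :
  symmetric r -> (forall j, r j j.+1) -> (forall j, r j j.+2) ->
  exists2 p, path r m.+1 (rcons p m) &
    perm_eq (m.+1 :: rcons p m) (iota 0 m.+2).
Proof.
move=> r_sym rS rSS; elim: m => [|m [p rp p_iota]].
  by exists [::]; rewrite //= r_sym rS.
exists (m :: rev p); first by rewrite /= r_sym rSS rev_path_rcons.
have -> : iota 0 m.+3 = iota 0 m.+2 ++ [:: m.+2] by rewrite -addn1 iotaD.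
rewrite perm_sym perm_catC perm_cons perm_sym; apply: perm_trans p_iota.
have -> : rcons (m :: rev p) m.+1 = rev (m.+1 :: rcons p m).
  by rewrite rev_cons rev_rcons.
by rewrite perm_rev.
Qed.

Lemma hamiltonian_path_square (r : rel nat) (n : nat) :
  symmetric r -> (forall j, r j j.+1) -> (forall j, r j j.+2) -> (2 < n)%N ->
  hamiltonian (fun v w : 'I_n => r v w).
Proof.
move=> r_sym rS rSS n_gt2.
have [m def_n] : exists m, n = m.+2.
  by exists n.-2; case: n n_gt2 => [|[]].
have [p rp p_iota] := path_square_spanning r m r_sym rS rSS.
apply: (hamiltonian_relpre_val _ _ (m.+1 :: rcons p m)) => //.
  by rewrite def_n.
by rewrite /= rcons_path rp last_rcons rS.
Qed.

(** * The two lowest coefficients of [g f^m] *)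

Section LowCoefficients.
Variable R : comNzRingType.
Implicit Types u v f g : fps R.

Lemma fps_mulu1 u (k : nat) : fps_mul u (fps_one R) k = u k.
Proof.
rewrite /fps_mul big_ord_recr big1 /= => [|i _].
  by rewrite /fps_one subnn mulr1 add0r.
by rewrite /fps_one subn_eq0 leqNgt ltn_ord mulr0.
Qed.

(** Factoring [t^a] out of [u] and [t^b] out of [v]. *)
Lemma fps_mul_shift u v (a b d : nat) :
  (forall k, (k < a)%N -> u k = 0) -> (forall k, (k < b)%N -> v k = 0) ->
  fps_mul u v (a + b + d)%N = \sum_(i < d.+1) u (a + i)%N * v (b + (d - i))%N.
Proof.
move=> u_low v_low; rewrite /fps_mul.
have -> : (a + b + d).+1 = (a + (d.+1 + b))%N by lia.
rewrite big_split_ord big_split_ord /=.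
rewrite big1 => [|i _]; last by rewrite u_low ?mul0r.
rewrite add0r [X in _ + X]big1 => [|i _].
  rewrite addr0; apply: eq_bigr => i _; congr (_ * v _).
  by have := ltn_ord i; lia.
by rewrite v_low ?mulr0 //; have := ltn_ord i; lia.
Qed.

Lemma fps_expS f (m : nat) : fps_exp f m.+1 = fps_mul f (fps_exp f m).
Proof. by []. Qed.

Lemma fps_exp_low f (m k : nat) : f 0%N = 0 -> (k < m)%N -> fps_exp f m k = 0.
Proof.
move=> f0; elim: m k => [|m IHm] k //= k_lt.
rewrite /fps_mul big1 // => i _; case: (posnP i) => [->|i_gt0].
  by rewrite f0 mul0r.
by rewrite [X in _ * X]IHm ?mulr0 //; have := ltn_ord i; lia.
Qed.

Lemma fps_exp_lead f (m : nat) : f 0%N = 0 -> fps_exp f m m = f 1%N ^+ m.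
Proof.
move=> f0; elim: m => [|m IHm]; first by rewrite /= /fps_one eqxx expr0.
rewrite fps_expS.
have := fps_mul_shift f (fps_exp f m) 1 m 0; rewrite addn0 add1n => -> //.
- by rewrite big_ord1 !addn0 IHm exprS.
- by case.
- by move=> k; apply: fps_exp_low.
Qed.

(** A term of degree [m + 1] takes [f_2 t^2] from one of the [m] factors and
    [f_1 t] from all others.  For [m = 0] the truncated exponent [m.-1] is
    harmless, as the multiple [*+ 0] is zero. *)
Lemma fps_exp_sublead f (m : nat) :
  f 0%N = 0 -> fps_exp f m m.+1 = f 1%N ^+ m.-1 * f 2%N *+ m.
Proof.
move=> f0; elim: m => [|m IHm]; first by rewrite /= /fps_one mulr0n.
rewrite fps_expS.
have := fps_mul_shift f (fps_exp f m) 1 m 1; rewrite addn1 add1n => -> //.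
- rewrite big_ord_recr big_ord1 /= !addn0 !addn1 IHm.
  rewrite fps_exp_lead // mulrSr [f 2%N * _]mulrC mulrnAr mulrA -exprS.
  by case: m {IHm}.
- by case.
- by move=> k; apply: fps_exp_low.
Qed.

Lemma riordan_coef_lead g f (m : nat) :
  f 0%N = 0 -> fps_mul g (fps_exp f m) m = g 0%N * f 1%N ^+ m.
Proof.
move=> f0; have := fps_mul_shift g (fps_exp f m) 0 m 0.
rewrite add0n addn0 => -> //; last by move=> k; apply: fps_exp_low.
by rewrite big_ord1 !addn0 fps_exp_lead.
Qed.

Lemma riordan_coef_sublead g f (m : nat) :
  f 0%N = 0 ->
  fps_mul g (fps_exp f m) m.+1 =
    g 1%N * f 1%N ^+ m + g 0%N * (f 1%N ^+ m.-1 * f 2%N *+ m).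
Proof.
move=> f0; have := fps_mul_shift g (fps_exp f m) 0 m 1.
rewrite add0n addn1 => -> //; last by move=> k; apply: fps_exp_low.
rewrite big_ord_recr big_ord1 /= !addn0 add0n addn1.
by rewrite fps_exp_lead // fps_exp_sublead // addrC.
Qed.

End LowCoefficients.

(** * Riordan graphs *)

(** Both coefficient rings reduce onto the integers mod 2; this replaces the
    case distinction in the definition of the congruence by ring algebra. *)
Lemma cong2_rmorph (c : coef_ring) :
  exists rho : {rmorphism c -> 'Z_2}, forall a b, cong2 a b = (rho a == rho b).
Proof.
case: c => /=.
  exists (intmul (1 : 'Z_2)) => a b.
  rewrite eqz_mod_dvd -subr_eq0 -rmorphB /=.
  by rewrite -(dvdz_pcharf (isT : 2%N \in [pchar 'Z_2])).
by exists idfun.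
Qed.

Section RiordanGraph.
Variables (c : coef_ring) (g f : fps c).

Lemma riordan_adjC : symmetric (riordan_adj g f).
Proof. by move=> i j; rewrite /riordan_adj orbC. Qed.

Lemma riordan_adj_gt (i j : nat) :
  (j < i)%N -> riordan_adj g f i j = riordan_entry g f i j.
Proof. by move=> ji; rewrite /riordan_adj ji ltnNge (ltnW ji) orbF. Qed.

Lemma riordan_adj_succ (j : nat) :
  f 0%N = 0 -> riordan_proper g f -> riordan_adj g f j.+1 j.+2.
Proof.
move=> f0; rewrite riordan_adjC riordan_adj_gt // /riordan_proper /riordan_entry.
rewrite !subSS !subn0 riordan_coef_lead //.
have [rho rhoE] := cong2_rmorph c; rewrite !rhoE rmorphM rmorphXn rmorph1.
by rewrite /fps_deriv mulr1n => /andP[/eqP-> /eqP->]; rewrite expr1n mulr1.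
Qed.

(** Modulo 2 the term with [f_2] disappears and the other one is [g_1]. *)
Lemma riordan_adj_succ2 (j : nat) :
  f 0%N = 0 -> riordan_proper g f -> cong2 (g 1%N) 1 -> cong2 (f 2%N) 0 ->
  riordan_adj g f j.+1 j.+3.
Proof.
move=> f0; rewrite riordan_adjC riordan_adj_gt // /riordan_proper /riordan_entry.
rewrite !subSS !subn0 riordan_coef_sublead //.
have [rho rhoE] := cong2_rmorph c; rewrite !rhoE rmorphD !rmorphM rmorphMn.
rewrite rmorphM rmorphXn rmorph1 rmorph0 /fps_deriv mulr1n.
move=> /andP[_ /eqP->] /eqP-> /eqP->.
by rewrite mulr0 mul0rn mulr0 addr0 expr1n mulr1.
Qed.

End RiordanGraph.

Theorem theorem3p21 (n : nat) (hn : (3 <= n)%N) (c : coef_ring) (g f : fps c)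
    (hf0 : f 0%N = 0) (hproper : riordan_proper g f)
    (hcond :
       (exists i : nat,
          [/\ (2 <= i <= n - 1)%N,
              cong2 (g (i - 1)%N) 1
            & cong2 (fps_mul g (fps_exp f (i - 1)%N) (n - 2)%N) 1])
       \/ (cong2 (g 1%N) 1 /\ cong2 (f 2%N) 0)) :
  hamiltonian (riordan_graph g f n).
Proof.
pose r : rel nat := fun v w => riordan_adj g f v.+1 w.+1.
have r_sym : symmetric r by move=> v w; apply: riordan_adjC.
have rS j : r j j.+1 by apply: riordan_adj_succ.
case: hcond => [[i [i_bounds g_i gf_i]] | [g1 f2]]; last first.
  apply: (hamiltonian_path_square r) => // j.
  exact: riordan_adj_succ2.
(* Vertices are numbered from 0 here, so the vertex [i] of the chords is [i - 1]. *)
apply: (hamiltonian_crossing_chords r n (i - 1)) => //; first lia.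
- rewrite r_sym /r riordan_adj_gt // /riordan_entry.
  by rewrite fps_mulu1; move: g_i; congr (cong2 (g _) _); lia.
- rewrite r_sym /r riordan_adj_gt; last lia.
  by rewrite /riordan_entry prednK ?subSS ?subn0 //; lia.
Qed.
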